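(* Let $d\ge1$, $\lambda>0$, and let $E=E_2(\lambda)$ be the $d\times d$ matrix with $\lambda$ on the diagonal, $1$ on the first superdiagonal and $0$ elsewhere. Define functions $\tau_i,\Phi_i$ on $\mathbb{R}^d$, $i\in\{1,\dots,d\}$, recursively as follows, for $\xi=(\xi_1,\dots,\xi_d)\in\mathbb{R}^d$: - for $i=1$: $\tau_1(\xi)=\Phi_1(\xi)=|\xi_1|$; - for $i\ge2$: $$\tau_i(\xi)=\begin{cases}|\xi_i| & \text{if }\xi_1=\xi_2=\cdots=\xi_{i-1}=0,\\ \Phi_{i-1}(\xi)\,\big(\Phi_{i-1}(\xi)^{-\lambda^{-1}E^t}\xi\big)_i&\text{otherwise,}\end{cases}$$ and $\Phi_i(\xi)=|\tau_1(\xi)|+\cdots+|\tau_i(\xi)|$. Then the function $\rho_2$ defined for $\xi\in\mathbb{R}^d$ by $\rho_2(\xi)=\Phi_d(\xi)^{1/\lambda}$ is an $(\mathbb{R}^d,E_2^t(\lambda))$ pseudo-norm.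
   Context: $M^t$ denotes the transpose of $M$, and $(v)_i$ the $i$-th coordinate of a vector $v$. For $a>0$ and a real square matrix $M$, $a^{M}=\exp(M\log a)$. For a real $d\times d$ matrix $M$ whose eigenvalues all have positive real parts, an $(\mathbb{R}^d,M)$ pseudo-norm is a continuous function $\rho:\mathbb{R}^d\to\mathbb{R}$ that is positive on $\mathbb{R}^d\setminus\{0\}$ and satisfies $\rho(a^{M}x)=a\rho(x)$ for all $x\in\mathbb{R}^d$, $a>0$. *)

(* Defs.v *)
From mathcomp Require Import all_boot all_order all_algebra.
From mathcomp Require Import complex.
From mathcomp Require Import all_classical all_reals all_analysis.

Set Implicit Arguments.
Unset Strict Implicit.
Unset Printing Implicit Defensive.

Import Order.TTheory GRing.Theory Num.Theory.
Import numFieldNormedType.Exports.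

Local Open Scope classical_set_scope.
Local Open Scope ring_scope.

Definition expmx (R : realType) (n : nat) (M : 'M[R]_n) : 'M[R]_n :=
  limn (series (fun k : nat => (k`!%:R)^-1 *: M ^+ k)).

(* Meaningful for 0 < a only: the convention ln 0 = 0 makes 0 ^ M the
   identity. *)
Definition powmx (R : realType) (n : nat) (a : R) (M : 'M[R]_n) : 'M[R]_n :=
  expmx (ln a *: M).

(* The standing assumption on M that gives the notion its meaning is included
   as the first field; eigenvalues are the complex ones. *)
Record pseudo_norm (R : realType) (n : nat) (M : 'M[R]_n)
    (rho : 'cV[R]_n -> R) : Prop := PseudoNorm {
  pseudo_norm_spectrum : forall z : R[i],
    eigenvalue (map_mx (real_complex R) M) z -> 0 < complex.Re z ;
  pseudo_norm_continuous : continuous rho ;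
  pseudo_norm_gt0 : forall x, x != 0 -> 0 < rho x ;
  pseudo_norm_homogeneous : forall (x : 'cV[R]_n) (a : R), 0 < a ->
    rho (powmx a M *m x) = a * rho x }.

Definition E2 (R : realType) (n : nat) (lambda : R) : 'M[R]_n :=
  \matrix_(i, j) if i == j then lambda
                 else if j == i.+1 :> nat then 1 else 0.

(* Indices start at 0 and the dimension is n.+1: tau i, Phi i and
   xi (inord i) 0 stand for tau_(i+1), Phi_(i+1) and xi_(i+1), and are only
   meaningful for i <= n. *)

(* The value of tau i.+1 in terms of p, the value of Phi i. *)
Definition tau_next (R : realType) (n : nat) (lambda : R) (i : nat) (p : R)
    (xi : 'cV[R]_n.+1) : R :=
  if [forall j : 'I_n.+1, (j <= i)%N ==> (xi j 0 == 0)]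
  then `|xi (inord i.+1) 0|
  else p * (powmx p (- (lambda^-1 *: (E2 n.+1 lambda)^T)) *m xi)
             (inord i.+1) 0.

(* Accumulates the sum of the absolute values of tau; see PhiE. *)
Fixpoint Phi (R : realType) (n : nat) (lambda : R) (i : nat)
    (xi : 'cV[R]_n.+1) : R :=
  if i is k.+1
  then Phi lambda k xi + `|tau_next lambda k (Phi lambda k xi) xi|
  else `|xi 0 0|.

Definition tau (R : realType) (n : nat) (lambda : R) (i : nat)
    (xi : 'cV[R]_n.+1) : R :=
  if i is k.+1 then tau_next lambda k (Phi lambda k xi) xi else `|xi 0 0|.

Lemma PhiE (R : realType) (n : nat) (lambda : R) (i : nat)
    (xi : 'cV[R]_n.+1) :
  Phi lambda i xi = \sum_(j < i.+1) `|tau lambda j xi|.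
Proof.
elim: i => [|i IHi]; first by rewrite big_ord1 /= normr_id.
by rewrite big_ord_recr -IHi.
Qed.

Definition rho2 (R : realType) (n : nat) (lambda : R) (xi : 'cV[R]_n.+1) : R :=
  Phi lambda n xi `^ (1 / lambda).

(* Main.v *)
(* Write U(t) = exp(t N), N the matrix with 1 on the first subdiagonal; then
   E^t = lambda + N gives p^(E^t / lambda) = p U(log p / lambda), and
   Phi_(k+1)(x) = Phi_k(x) + |(U(- log Phi_k(x) / lambda) x)_(k+1)| in both
   cases of the definition. Homogeneity is then U(s + t) = U(s) U(t). The
   continuity of Phi_(k+1) at a zero of Phi_k rests on a stronger induction:
   along any filter on which Phi_k tends to 0, (log Phi_k)^m x_j tends to 0 for
   all j <= k and all m. For j = k + 1 one solves for x_(k+1) in the recursion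
   and uses s (log s)^m -> 0 together with |log Phi_(k+1)| <= |log Phi_k|. *)
Require Import Defs.
From mathcomp Require Import all_boot all_order all_algebra.
From mathcomp Require Import complex ring lra zify.
From mathcomp Require Import all_classical all_reals all_analysis.

Set Implicit Arguments.
Unset Strict Implicit.
Unset Printing Implicit Defensive.

Import Order.TTheory GRing.Theory Num.Theory.
Import numFieldNormedType.Exports.

Local Open Scope classical_set_scope.
Local Open Scope ring_scope.

(** * Exponential of a nilpotent matrix plus a scalar *)

Lemma horner_mx_nilpotent (R : comNzRingType) (n N : nat) (L : 'M[R]_n.+1)
    (p : {poly R}) :
  L ^+ N = 0 -> horner_mx L p = \sum_(m < N) p`_m *: L ^+ m.
Proof.
move=> LN0; rewrite -[p in LHS](poly_take_drop N) rmorphD rmorphM /=.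
rewrite rmorphXn /= horner_mx_X LN0 mulr0 addr0 /take_poly poly_def rmorph_sum.
by apply: eq_bigr => m _; rewrite /= horner_mxZ rmorphXn /= horner_mx_X.
Qed.

Lemma coef_exp_addXC (R : comNzRingType) (c : R) (k m : nat) :
  (('X + c%:P) ^+ k)`_m = c ^+ (k - m) *+ 'C(k, m).
Proof.
have -> : ('X + c%:P) ^+ k = \poly_(i < k.+1) (c ^+ (k - i) *+ 'C(k, i)).
  rewrite addrC exprDn poly_def; apply: eq_bigr => i _.
  by rewrite -mul_polyC -polyC_exp polyCMn mulrnAl.
by rewrite coef_poly ltnS; case: leqP => // km; rewrite bin_small.
Qed.

Lemma exp_coeffD (R : realType) (s t : R) (m : nat) :
  \sum_(j < m.+1) exp_coeff s j * exp_coeff t (m - j)%N = exp_coeff (s + t) m.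
Proof.
rewrite /exp_coeff /= addrC exprDn mulr_suml; apply: eq_bigr => j _.
have jm : (j <= m)%N by rewrite -ltnS.
rewrite -mulr_natr -(bin_fact jm) !natrM.
have fact_neq0 k : k`!%:R != 0 :> R by rewrite pnatr_eq0 -lt0n fact_gt0.
have bin_neq0 : 'C(m, j)%:R != 0 :> R by rewrite pnatr_eq0 -lt0n bin_gt0.
by field; rewrite !fact_neq0 bin_neq0.
Qed.

(** This is the coefficient of L^m in the exponential series of t(L + c). The terms with k < m
    vanish; after a shift by m, the identity C(k+m, m) m! k! = (k+m)! splits t^m / m! off the series
    of exp(tc). *)
Lemma cvg_series_exp_binomial (R : realType) (c t : R) (m : nat) :
  series (fun k => (k`!%:R)^-1 * (t ^+ k * (c ^+ (k - m) *+ 'C(k, m))))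
    @ \oo --> expR (t * c) * exp_coeff t m.
Proof.
rewrite -(cvg_shiftn m).
suff -> : [sequence series (fun k =>
    (k`!%:R)^-1 * (t ^+ k * (c ^+ (k - m) *+ 'C(k, m)))) (K + m)%N]_K
    = (fun K => series (exp_coeff (t * c)) K * exp_coeff t m).
  by apply: cvgMr_tmp; exact: is_cvg_series_exp_coeff.
apply/funext => K /=; rewrite !seriesEnat /= (big_cat_nat (n := m)) ?leq_addl//=.
rewrite big_nat big1 ?add0r => [|k /andP[_ km]]; last first.
  by rewrite bin_small // mulr0n !mulr0.
rewrite -{1}[m]add0n big_addn addnK mulr_suml; apply: eq_bigr => k _.
rewrite /exp_coeff /= addnK exprD exprMn -mulr_natr.
have /(congr1 (fun x => x%:R : R)) := bin_fact (leq_addl k m).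
rewrite addnK !natrM => <-.
have fact_neq0 i : i`!%:R != 0 :> R by rewrite pnatr_eq0 -lt0n fact_gt0.
have bin_neq0 : 'C(k + m, m)%:R != 0 :> R.
  by rewrite pnatr_eq0 -lt0n bin_gt0 leq_addl.
by field; rewrite !fact_neq0 bin_neq0.
Qed.

(** The power (L + c)^k is the value at L of (X + c)^k, of which only the degrees below N survive.
    The matrix series thus splits into N scalar series, one for each power of L. *)
Lemma expmx_scalar_nilpotent (R : realType) (n N : nat) (L : 'M[R]_n.+1)
    (c t : R) :
  L ^+ N = 0 ->
  expmx (t *: (L + c%:M)) =
  expR (t * c) *: \sum_(m < N) exp_coeff t m *: L ^+ m.
Proof.
move=> LN0; apply: cvg_lim => //.
have -> : series (fun k => (k`!%:R)^-1 *: (t *: (L + c%:M)) ^+ k)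
    = (fun K => \sum_(m < N) series (fun k =>
        (k`!%:R)^-1 * (t ^+ k * (c ^+ (k - m) *+ 'C(k, m)))) K *: L ^+ m).
  apply/funext => K; rewrite seriesEnat /=.
  transitivity (\sum_(0 <= k < K) \sum_(m < N)
      ((k`!%:R)^-1 * (t ^+ k * (c ^+ (k - m) *+ 'C(k, m)))) *: L ^+ m).
    apply: eq_bigr => k _.
    have -> : L + c%:M = horner_mx L ('X + c%:P).
      by rewrite rmorphD /= horner_mx_X horner_mx_C.
    rewrite exprZn -rmorphXn /= (horner_mx_nilpotent _ LN0) !scaler_sumr.
    by apply: eq_bigr => m _; rewrite coef_exp_addXC !scalerA mulrA.
  rewrite exchange_big /=; apply: eq_bigr => m _.
  by rewrite seriesEnat /= scaler_suml.
rewrite scaler_sumr; apply: cvg_big => [|m _]; first exact: add_continuous.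
by rewrite scalerA; apply: cvgZr_tmp; exact: cvg_series_exp_binomial.
Qed.

(* The exponential of t times the matrix with 1 on the first subdiagonal and
   0 elsewhere; exp_coeff t m is t ^+ m / m`!. *)
Definition unip (R : realType) (n : nat) (t : R) : 'M[R]_n :=
  \matrix_(i, j) if (j <= i)%N then exp_coeff t (i - j)%N else 0.

(** * Group law of the matrices [unip], and powers with exponent t E^t *)

Section Unipotent.
Variables (R : realType) (n : nat).
Implicit Types (s t c : R) (m : nat) (x : 'cV[R]_n.+1).

Local Notation L := (E2 n.+1 (0 : R))^T.

Lemma exp_E20E m (i j : 'I_n.+1) : (L ^+ m) i j = (i == j + m :> nat)%N%:R.
Proof.
elim: m j => [|m IHm] j; first by rewrite expr0 mxE addn0.
rewrite exprSr mxE.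
have entryE (k : 'I_n.+1) : L k j = (k == j.+1 :> nat)%N%:R.
  rewrite !mxE; case: ifP => [/eqP ->|_]; last by case: ifP.
  by rewrite ltn_eqF.
(* Column j of L has a single 1, in row j + 1; the last column is zero. *)
have [jn|nj] := ltnP j n.
  rewrite (bigD1 (inord j.+1)) //= big1 ?addr0 => [|k kj].
    by rewrite IHm entryE inordK // eqxx mulr1 addSnnS.
  rewrite entryE; case: eqP => [kE|]; last by rewrite mulr0.
  by rewrite -kE inord_val eqxx in kj.
rewrite big1 => [|k _]; last first.
  by rewrite entryE ltn_eqF ?mulr0 // (leq_trans (ltn_ord k)).
by rewrite ltn_eqF // addnS ltnS (leq_trans _ (leq_addr _ _)) // (leq_trans _ nj) // -ltnS.
Qed.

Lemma exp_E20_eq0 : L ^+ n.+1 = 0.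
Proof.
apply/matrixP => i j; rewrite exp_E20E mxE ltn_eqF //.
by rewrite (leq_trans (ltn_ord i)) // leq_addl.
Qed.

Lemma unipE t : unip n.+1 t = \sum_(m < n.+1) exp_coeff t m *: L ^+ m.
Proof.
apply/matrixP => i j; rewrite mxE summxE.
under eq_bigr do rewrite mxE exp_E20E.
case: leqP => [ji|ij]; last first.
  by rewrite big1 // => m _; rewrite ltn_eqF ?mulr0 // (leq_trans ij) // leq_addr.
have ijn : (i - j < n.+1)%N by rewrite (leq_ltn_trans (leq_subr _ _)).
rewrite (bigD1 (Ordinal ijn)) //= subnKC // eqxx mulr1 big1 ?addr0 // => m mE.
case: eqP => [iE|]; last by rewrite mulr0.
by case/eqP: mE; apply/val_inj; rewrite /= iE addKn.
Qed.

Lemma unipD s t : unip n.+1 (s + t) = unip n.+1 s *m unip n.+1 t.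
Proof.
(* Truncated exponentials: modulo X^(n+1), which L annihilates, the product of [p s] and [p t] is
   [p (s + t)] by [exp_coeffD]. *)
pose p u := \poly_(m < n.+1) exp_coeff u m : {poly R}.
have hornerE u : unip n.+1 u = horner_mx L (p u).
  rewrite unipE (horner_mx_nilpotent _ exp_E20_eq0); apply: eq_bigr => m _.
  by rewrite coef_poly ltn_ord.
rewrite [in RHS]hornerE [X in _ *m X]hornerE.
have -> : horner_mx L (p s) *m horner_mx L (p t) = horner_mx L (p s * p t).
  by rewrite rmorphM.
rewrite unipE (horner_mx_nilpotent _ exp_E20_eq0); apply: eq_bigr => m _.
rewrite coefM -exp_coeffD; congr (_ *: _); apply: eq_bigr => j _.
have jn : (j < n.+1)%N by rewrite (leq_trans (ltn_ord j)).
by rewrite !coef_poly jn (leq_ltn_trans (leq_subr _ _)).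
Qed.

Lemma trmx_E2 c : (E2 n.+1 c)^T = L + c%:M.
Proof.
apply/matrixP => i j; rewrite !mxE [j == i]eq_sym.
by case: eqP => _; rewrite ?addr0 ?add0r.
Qed.

Lemma powmx_trmx_E2 (a c t : R) :
  powmx a (t *: (E2 n.+1 c)^T) = expR (t * ln a * c) *: unip n.+1 (t * ln a).
Proof.
rewrite /powmx scalerA [ln a * t]mulrC trmx_E2 unipE.
exact: expmx_scalar_nilpotent exp_E20_eq0.
Qed.

End Unipotent.

(** * Powers of the logarithm near 0 *)

Lemma cvg0_dominated (R : realType) (T : Type) (F : set_system T)
    (FF : Filter F) (f g : T -> R) :
  (\forall x \near F, `|f x| <= `|g x|) ->
  g x @[x --> F] --> (0 : R) -> f x @[x --> F] --> (0 : R).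
Proof.
move=> fg /cvgr0Pnorm_lt g0; apply/cvgr0Pnorm_lt => e e0.
by apply: filterS2 fg (g0 e e0) => x; exact: le_lt_trans.
Qed.

Lemma normr_ln_le (R : realType) (x y : R) :
  0 < x -> x <= y -> y <= 1 -> `|ln y| <= `|ln x|.
Proof.
move=> x0 xy y1; have y0 := lt_le_trans x0 xy.
by rewrite !ler0_norm ?ln_le0 ?(le_trans xy) // lerN2 ler_ln.
Qed.

(* With u = - ln x / (2 m + 2), the bound u <= expR u gives
   (- ln x) ^+ m <= (2 m + 2) ^+ m / sqrt x. *)
Lemma normr_mul_lnX_le (R : realType) (m : nat) (x : R) :
  0 < x -> x <= 1 ->
  `|x * ln x ^+ m| <= (m.+1.*2%:R) ^+ m * Num.sqrt x.
Proof.
move=> x0 x1; set N : R := m.+1.*2%:R.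
have N0 : 0 < N by rewrite ltr0n double_gt0.
have s0 : 0 < Num.sqrt x by rewrite sqrtr_gt0.
have lnx : 0 <= - ln x by rewrite oppr_ge0 ln_le0.
have sE : expR (- ln x / 2) = (Num.sqrt x)^-1.
  rewrite -powR12_sqrt ?ltW // /powR gt_eqF // -expRN; congr expR; lra.
have bound : (- ln x) ^+ m <= N ^+ m / Num.sqrt x.
  have uE : - ln x = N * (- ln x / N) by field; rewrite gt_eqF.
  rewrite {1}uE exprMn ler_wpM2l ?exprn_ge0 ?(ltW N0) // -sE.
  apply: (@le_trans _ _ (expR (- ln x / N) ^+ m)).
    apply: lerXn2r; rewrite ?nnegrE ?expR_ge0 ?divr_ge0 ?(ltW N0) //.
    by have := expR_ge1Dx (- ln x / N); lra.
  rewrite -expRM_natr ler_expR -mulrA ler_wpM2l // mulrC.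
  rewrite ler_pdivrMr // mulrC -[_ * _]mulrC ler_pdivlMl // /N.
  by rewrite -natrM ler_nat; lia.
rewrite normrM normrX (ger0_norm (ltW x0)) (ler0_norm (ln_le0 x1)).
apply: (le_trans (ler_wpM2l (ltW x0) bound)).
by rewrite -{1}(sqr_sqrtr (ltW x0)) expr2 mulrCA mulfK ?gt_eqF.
Qed.

Lemma cvg_mul_lnX (R : realType) (m : nat) :
  x * ln x ^+ m @[x --> (0 : R)] --> (0 : R).
Proof.
pose C : R := m.+1.*2%:R ^+ m.
apply: (@cvg0_dominated _ _ _ _ _ (fun x => C * Num.sqrt `|x|)).
  have near1 : \forall x \near (0 : R), `|x| < 1.
    by apply: (@cvgr0_norm_lt _ _ _ (nbhs (0 : R)) _ id) => //; exact: cvg_id.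
  have C1 : 1 <= C by rewrite exprn_ege1 // ler1n double_gt0.
  apply: filterS near1 => x x1.
  rewrite (ger0_norm (mulr_ge0 (le_trans ler01 C1) (sqrtr_ge0 _))).
  have [x0|x0] := ltP 0 x.
    move: x1; rewrite gtr0_norm // => x1.
    exact: normr_mul_lnX_le (ltW x1).
  (* The limit is over a full neighbourhood of 0; for x <= 0 the convention [ln x = 0] leaves x 0^m,
     and |x| <= sqrt |x| as |x| < 1. *)
  apply: (@le_trans _ _ `|x|).
    rewrite ln0 // normrM ler_piMr // expr0n.
    by rewrite normr_nat lern1 leq_b1.
  apply: (@le_trans _ _ (Num.sqrt `|x|)); last by rewrite ler_peMl ?sqrtr_ge0.
  have s1 : Num.sqrt `|x| <= 1 by rewrite -sqrtr1 ler_wsqrtr // ltW.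
  by rewrite -{1}(sqr_sqrtr (normr_ge0 x)) expr2 ler_piMr ?sqrtr_ge0.
rewrite -[X in _ --> X](mulr0 C); apply: cvgMl_tmp.
have := cvg_comp _ _ (@norm_continuous R R 0) (@sqrt_continuous R `|0 : R|).
by rewrite normr0 sqrtr0.
Qed.

(** * Zeros, homogeneity and continuity of the functions [Phi] *)

Section Phi_theory.
Variables (R : realType) (n : nat) (lambda : R).
Hypothesis lambda_gt0 : 0 < lambda.
Implicit Types (x : 'cV[R]_n.+1) (i j : 'I_n.+1) (k m : nat) (t : R).

Local Notation U := (unip n.+1).
Local Notation Phi := (Phi (n := n) lambda).

Lemma unip_mulmxE t x i :
  (U t *m x) i 0 =
  x i 0 + \sum_(j < n.+1 | (j < i)%N) exp_coeff t (i - j)%N * x j 0.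
Proof.
rewrite mxE (bigD1 i) //= mxE leqnn subnn /exp_coeff /= fact0 expr0 divr1 mul1r.
congr (_ + _); rewrite [RHS]big_mkcond [LHS]big_mkcond /=.
apply: eq_bigr => j _; rewrite mxE.
have [->|ji] := eqVneq j i; first by rewrite ltnn.
rewrite [(j < i)%N]ltn_neqAle ji /=.
by case: ifP => // _; rewrite mul0r.
Qed.

Lemma unip_mulmx_id t x i :
  (forall j, (j < i)%N -> x j 0 = 0) -> (U t *m x) i 0 = x i 0.
Proof.
move=> x0; rewrite unip_mulmxE big1 ?addr0 // => j /x0 ->; exact: mulr0.
Qed.

Lemma Phi_ge0 k x : 0 <= Phi k x.
Proof. by elim: k => [|k IHk] //=; rewrite addr_ge0. Qed.

Lemma Phi_leS k x : Phi k x <= Phi k.+1 x.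
Proof. by rewrite /= lerDl. Qed.

(** Identifies the case test of [tau_next] with the vanishing of [Phi k]. When the test succeeds,
    the next summand is the absolute value of the next coordinate, which drives the induction. *)
Lemma Phi_eq0 k x : (k <= n)%N ->
  (Phi k x == 0) = [forall j : 'I_n.+1, (j <= k)%N ==> (x j 0 == 0)].
Proof.
elim: k => [|k IHk] kn.
  rewrite /= normr_eq0; apply/idP/forallP => [x0 j|/(_ ord0)]; last exact.
  by apply/implyP; rewrite leqn0 => /eqP j0; rewrite (_ : j = 0) //; apply/val_inj.
rewrite /= paddr_eq0 ?Phi_ge0 // normr_eq0 (IHk (ltnW kn)) /tau_next.
case: (boolP [forall _, _]) => [/forallP xk0|xk]; last first.
  apply/esym; apply: contraNF xk => /forallP x0; apply/forallP => j.
  by apply/implyP => jk; apply: (implyP (x0 j)); rewrite ltnW.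
rewrite normr_eq0; apply/idP/forallP => [x0 j|/(_ (inord k.+1))]; last first.
  by rewrite inordK //= leqnn.
apply/implyP; rewrite leq_eqVlt ltnS => /orP[/eqP jk|jk].
  by rewrite -jk inord_val in x0.
exact: (implyP (xk0 j)).
Qed.

Lemma Phi_eq0_coord k x j :
  (k <= n)%N -> Phi k x = 0 -> (j <= k)%N -> x j 0 = 0.
Proof.
by move=> kn /eqP; rewrite Phi_eq0 // => /forallP/(_ j)/implyP x0 /x0/eqP.
Qed.

(* No case distinction is needed: if x_1 = ... = x_k = 0 then the coordinate
   k + 1 of x is fixed by every U t. *)
Lemma PhiS k x : (k < n)%N ->
  Phi k.+1 x =
  Phi k x + `|(U (- lambda^-1 * ln (Phi k x)) *m x) (inord k.+1) 0|.
Proof.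
move=> kn /=; congr (_ + _); rewrite /tau_next -Phi_eq0 1?ltnW //.
case: ifPn => [/eqP p0|p0].
  rewrite unip_mulmx_id ?normr_id // => j; rewrite inordK // ltnS.
  exact: Phi_eq0_coord (ltnW kn) p0.
have p_gt0 : 0 < Phi k x by rewrite lt_def p0 Phi_ge0.
rewrite -scaleNr powmx_trmx_E2 -scalemxAl mxE mulrA.
have -> : - lambda^-1 * ln (Phi k x) * lambda = - ln (Phi k x).
  by field; rewrite gt_eqF.
by rewrite expRN lnK // divff // mul1r.
Qed.

(** Scaling [Phi k] by e^t shifts the parameter - ln(Phi_k) / lambda by - t / lambda, and the group
    law cancels this against the U(t / lambda) applied to x. *)
Lemma Phi_homogeneous k t x : (k <= n)%N ->
  Phi k (expR t *: (U (lambda^-1 * t) *m x)) = expR t * Phi k x.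
Proof.
elim: k => [|k IHk] kn.
  by rewrite /= mxE unip_mulmx_id // normrM (ger0_norm (expR_ge0 _)).
rewrite !PhiS // (IHk (ltnW kn)) mulrDr; congr (_ + _).
rewrite -[X in X * `|_|](ger0_norm (expR_ge0 t)) -normrM.
rewrite -scalemxAr mxE mulmxA -unipD; congr `|_ * _|.
(* At a zero of [Phi k] the logarithm does not shift, but every U fixes the coordinate in
   question. *)
have [p0|p0] := eqVneq (Phi k x) 0.
  have x0 j : (j < @inord n k.+1)%N -> x j 0 = 0.
    by rewrite inordK // ltnS; exact: Phi_eq0_coord (ltnW kn) p0.
  by rewrite !unip_mulmx_id.
have p_gt0 : 0 < Phi k x by rewrite lt_def p0 Phi_ge0.
rewrite lnM ?posrE ?expR_gt0 // expRK; congr ((unip _ _ *m _) _ _).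
by rewrite mulrDr mulNr addrAC addNr add0r.
Qed.

(** Since |ln| decreases on (0, 1], the larger [Phi k.+1] has the smaller logarithm. If
    [Phi k x = 0], where [ln 0 = 0] spoils this, the factor [x j 0] vanishes. *)
Lemma normr_lnX_Phi_le k m x j : (k < n)%N -> (j <= k)%N -> Phi k.+1 x <= 1 ->
  `|ln (Phi k.+1 x) ^+ m * x j 0| <= `|ln (Phi k x) ^+ m * x j 0|.
Proof.
move=> kn jk p1; have [p0|p0] := eqVneq (Phi k x) 0.
  by rewrite (Phi_eq0_coord (ltnW kn) p0 jk) !mulr0.
rewrite !normrM ler_wpM2r // !normrX lerXn2r ?nnegrE // normr_ln_le //.
  by rewrite lt_def p0 Phi_ge0.
exact: Phi_leS.
Qed.

Lemma cvg_lnX_Phi (F : set_system 'cV[R]_n.+1) (FF : Filter F) k m j :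
  (k <= n)%N -> (j <= k)%N -> Phi k x @[x --> F] --> (0 : R) ->
  ln (Phi k x) ^+ m * x j 0 @[x --> F] --> (0 : R).
Proof.
elim: k m j => [|k IHk] m j kn jk p0.
  have {jk}-> : j = 0 by apply/val_inj/eqP; rewrite -leqn0.
  apply: (@cvg0_dominated _ _ _ _ _ (fun x => Phi 0 x * ln (Phi 0 x) ^+ m)).
    by apply: nearW => x; rewrite mulrC !normrM /= normr_id.
  exact: (cvg_comp _ _ p0 (@cvg_mul_lnX R m)).
have pk0 : Phi k x @[x --> F] --> (0 : R).
  apply: cvg0_dominated p0; apply: nearW => x.
  by rewrite !ger0_norm ?Phi_ge0 ?Phi_leS.
have near1 : \forall x \near F, Phi k.+1 x <= 1.
  have /cvgr0Pnorm_le/(_ 1 ltr01) := p0; apply: filterS => x.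
  by rewrite ger0_norm // Phi_ge0.
(* Trading the logarithms of [Phi k.+1] for those of [Phi k] reduces mixed products to the induction
   hypothesis with exponent m + r. *)
have le_k r i : (i <= k)%N ->
    ln (Phi k.+1 x) ^+ m * (ln (Phi k x) ^+ r * x i 0) @[x --> F] --> (0 : R).
  move=> ik; apply: cvg0_dominated (IHk (m + r)%N i (ltnW kn) ik pk0).
  apply: filterS near1 => x p1.
  rewrite mulrCA exprD [in leRHS]mulrAC mulrC [in leRHS]normrM normrM.
  by rewrite ler_wpM2r // normr_lnX_Phi_le.
have [{}jk|jk'] := leqP j k.
  have -> : (fun x => ln (Phi k.+1 x) ^+ m * x j 0) =
      (fun x => ln (Phi k.+1 x) ^+ m * (ln (Phi k x) ^+ 0 * x j 0)).
    by apply/funext => x; rewrite expr0 mul1r.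
  exact: le_k.
have jE : j = inord k.+1.
  by apply/val_inj; rewrite /= inordK //; apply/eqP; rewrite eqn_leq jk.
(* |u| is the increment from [Phi k] to [Phi k.+1], hence at most [Phi k.+1]; [x j 0] is u minus a
   combination of earlier coordinates covered by [le_k]. *)
pose u x := (U (- lambda^-1 * ln (Phi k x)) *m x) j 0.
have -> : (fun x => ln (Phi k.+1 x) ^+ m * x j 0) = (fun x =>
    ln (Phi k.+1 x) ^+ m * u x - \sum_(i < n.+1 | (i < j)%N)
      ((- lambda^-1) ^+ (j - i) / (j - i)`!%:R) *
      (ln (Phi k.+1 x) ^+ m * (ln (Phi k x) ^+ (j - i) * x i 0))).
  apply/funext => x; rewrite /u unip_mulmxE mulrDr mulr_sumr -addrA.
  rewrite -sumrB big1 ?addr0 // => i _; rewrite /exp_coeff /= exprMn.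
  by ring.
rewrite -[X in _ --> X]subr0; apply: cvgB.
  apply: (@cvg0_dominated _ _ _ _ _ (fun x => Phi k.+1 x * ln (Phi k.+1 x) ^+ m)).
    apply: nearW => x; rewrite mulrC !normrM ler_wpM2r // (ger0_norm (Phi_ge0 _ _)).
    by rewrite PhiS // /u jE lerDr Phi_ge0.
  exact: (cvg_comp _ _ p0 (@cvg_mul_lnX R m)).
have {2}<- : \sum_(i < n.+1 | (i < j)%N) (0 : R) = 0 by rewrite big1.
apply: cvg_big => [|i ij]; first exact: add_continuous.
rewrite -[X in _ --> X](mulr0 ((- lambda^-1) ^+ (j - i) / (j - i)`!%:R)).
apply: cvgMl_tmp; apply: le_k; rewrite -ltnS.
by rewrite (leq_trans ij).
Qed.

(** Once expanded, the increment involves y only through its next coordinate and products (ln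
    Phi_k)^r y_j with j <= k, so it suffices that these converge. *)
Lemma cvg_Phi (F : set_system 'cV[R]_n.+1) (FF : Filter F) k x :
  (k <= n)%N -> (forall j, y j 0 @[y --> F] --> x j 0) ->
  Phi k y @[y --> F] --> Phi k x.
Proof.
move=> + Fx; elim: k => [|k IHk] kn.
  by apply: cvg_norm; exact: Fx.
have term r j : (j <= k)%N ->
    ln (Phi k y) ^+ r * y j 0 @[y --> F] --> ln (Phi k x) ^+ r * x j 0.
  (* Continuity of [ln] fails at 0; there [cvg_lnX_Phi] gives the limit 0, which is the value since
     [x j 0 = 0]. *)
  move=> jk; have [p0|p0] := eqVneq (Phi k x) 0.
    rewrite (Phi_eq0_coord (ltnW kn) p0 jk) mulr0.
    by apply: cvg_lnX_Phi (ltnW kn) jk _; rewrite -p0; exact: IHk (ltnW kn).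
  apply: cvgM; last exact: Fx.
  have lnp : ln (Phi k y) @[y --> F] --> ln (Phi k x).
    apply: (cvg_comp _ _ (IHk (ltnW kn))).
    by apply: continuous_ln; rewrite lt_def p0 Phi_ge0.
  exact: (cvg_comp _ _ lnp (@exprn_continuous R r _)).
have -> : Phi k.+1 = fun y =>
    Phi k y + `|y (inord k.+1) 0 + \sum_(j < n.+1 | (j < @inord n k.+1)%N)
      ((- lambda^-1) ^+ (@inord n k.+1 - j) / (@inord n k.+1 - j)`!%:R) *
      (ln (Phi k y) ^+ (@inord n k.+1 - j) * y j 0)|.
  apply/funext => y; rewrite PhiS // unip_mulmxE; congr (_ + `|_ + _|).
  by apply: eq_bigr => j _; rewrite /exp_coeff /= exprMn; ring.
apply: cvgD; first exact: IHk (ltnW kn).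
apply: cvg_norm; apply: cvgD; first exact: Fx.
apply: cvg_big => [|j]; first exact: add_continuous.
by rewrite inordK // => jk; apply: cvgMl_tmp; exact: term.
Qed.

Lemma continuous_Phi k : (k <= n)%N -> continuous (Phi k).
Proof.
move=> kn x; apply: (cvg_Phi (nbhs_filter (x : 'cV[R]_n.+1)) kn) => j.
exact: (@coord_continuous R n.+1 1 j 0 x).
Qed.

End Phi_theory.

(** * The power 1 / lambda and the pseudo-norm properties *)

Lemma cvg_powR_pos (R : realType) (T : Type) (F : set_system T)
    (FF : Filter F) (f : T -> R) (l r : R) :
  0 < r -> (forall y, 0 <= f y) -> 0 <= l -> f y @[y --> F] --> l ->
  f y `^ r @[y --> F] --> l `^ r.
Proof.
move=> r0 f0 l0 fl; move: l0; rewrite le_eqVlt => /predU1P[l0|l0].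
  rewrite -l0 powR0 ?gt_eqF //; apply/cvgr0Pnorm_lt => e e0.
  have e'0 : 0 < e `^ r^-1 by rewrite powR_gt0.
  rewrite -l0 in fl; move/cvgr0Pnorm_lt/(_ _ e'0): fl; apply: filterS => y.
  rewrite !ger0_norm ?powR_ge0 // => fe.
  have := gt0_ltr_powR r0 (f0 y) (ltW e'0) fe.
  by rewrite -powRrM mulVf ?gt_eqF // powRr1 // ltW.
apply: (cvg_comp f (fun y => y `^ r) fl).
suff : {for l, continuous (fun y : R => y `^ r)} by [].
apply: differentiable_continuous; apply/derivable1_diffP.
by apply: derivable_powR; rewrite in_itv /= l0.
Qed.

Theorem lemma3p2 (R : realType) (n : nat) (lambda : R) (lambda_gt0 : 0 < lambda) :
  pseudo_norm (E2 n.+1 lambda)^T (rho2 (n := n) lambda).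
Proof.
have ilambda_gt0 : 0 < 1 / lambda by rewrite divr_gt0.
split=> [z|x|x x0|x a a0].
(* The matrix is lower triangular, so its characteristic polynomial is (X - lambda)^(n+1). *)
- rewrite eigenvalue_root_char char_poly_trig; last first.
    apply/is_trig_mxP => i j ij; rewrite !mxE.
    by rewrite [j == i]eq_sym !ifN ?neq_ltn ?ij // (leq_trans ij) ?leqnSn ?orbT.
  have -> : \prod_(i < n.+1) ('X - (map_mx (real_complex R) (E2 n.+1 lambda)^T i i)%:P)
      = ('X - (real_complex R lambda)%:P) ^+ n.+1.
    rewrite -[n.+1 in RHS]card_ord -prodr_const.
    by apply: eq_bigr => i _; rewrite !mxE eqxx.
  by rewrite root_exp_XsubC => /eqP ->.
- apply: (cvg_powR_pos (nbhs_filter (x : 'cV[R]_n.+1)) ilambda_gt0).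
  + exact: Phi_ge0.
  + exact: Phi_ge0.
  + exact: (@continuous_Phi _ _ _ lambda_gt0 n (leqnn n) x).
- rewrite /rho2 powR_gt0 // lt_def Phi_ge0 andbT.
  apply: contraNN x0 => /eqP p0; apply/eqP/matrixP => i j.
  by rewrite ord1 mxE (Phi_eq0_coord (leqnn n) p0) // -ltnS.
- rewrite -[_^T]scale1r powmx_trmx_E2 mul1r -scalemxAl.
  (* Writing ln a as lambda^-1 (lambda ln a) allows [Phi_homogeneous] with t = lambda ln a; [Phi] is
     multiplied by a^lambda, whose power 1 / lambda is a. *)
  rewrite -[X in unip _ X](mulKf (lt0r_neq0 lambda_gt0)).
  rewrite /rho2 [lambda * ln a]mulrC Phi_homogeneous // powRM ?expR_ge0 ?Phi_ge0 //.
  congr (_ * _).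
  rewrite /powR gt_eqF ?expR_gt0 // expRK.
  have -> : 1 / lambda * (ln a * lambda) = ln a by field; rewrite gt_eqF.
  by rewrite lnK.
Qed.
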